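(* Let $r>0$, $0\le R<\infty$, $\varkappa=R/r$, and let $P$ be a random point uniformly distributed over the area of the disk $D_R$. Let $A_\varkappa$ be the area of the ellipse generated by $P$ under the elliptic motion, and let $F_\varkappa(x)=\mathbb{P}[A_\varkappa\le x]$, $x\in\mathbb{R}$, be its distribution function. 1) If $0\le\varkappa\le 1$, then $$ F_\varkappa(x)= \begin{cases} 0 & \text{if } -\infty<x<\pi r^2(1-\varkappa^2),\\[2pt] 1-\dfrac{1}{\varkappa^2}\left(1-\dfrac{x}{\pi r^2}\right) & \text{if } \pi r^2(1-\varkappa^2)\le x<\pi r^2,\\[6pt] 1 & \text{if } \pi r^2\le x<\infty. \end{cases} $$ 2) If $1\le\varkappa\le\sqrt{2}$, then $$ F_\varkappa(x)= \begin{cases} 0 & \text{if } -\infty<x<0,\\[2pt] \dfrac{2x}{\pi r^2\varkappa^2} & \text{if } 0\le x<\pi r^2(\varkappa^2-1),\\[6pt] 1-\dfrac{1}{\varkappa^2}\left(1-\dfrac{x}{\pi r^2}\right) & \text{if } \pi r^2(\varkappa^2-1)\le x<\pi r^2,\\[6pt] 1 & \text{if } \pi r^2\le x<\infty. \end{cases} $$ 3) If $\sqrt{2}\le\varkappa<\infty$, then $$ F_\varkappa(x)= \begin{cases} 0 & \text{if } -\infty<x<0,\\[2pt] \dfrac{2x}{\pi r^2\varkappa^2} & \text{if } 0\le x<\pi r^2,\\[6pt] \dfrac{1}{\varkappa^2}\left(1+\dfrac{x}{\pi r^2}\right) & \text{if } \pi r^2\le x<\pi r^2(\varkappa^2-1),\\[6pt]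 1 & \text{if } \pi r^2(\varkappa^2-1)\le x<\infty. \end{cases} $$
   Context: Elliptic motion: a circle of radius $r$ with centre $\varOmega$, attached to a moving plane $\varSigma$ with Cartesian coordinates $(\xi,\eta)$ and origin $\varOmega$, rolls inside a fixed circle of radius $2r$ centred at the origin $O$ of a fixed plane. A point $P=(\xi,\eta)\in\varSigma$ generates in the fixed plane (identified with $\mathbb{C}$) the closed curve $$X(\varphi)=r\,\mathrm{e}^{\mathrm{i}\varphi}+(\xi+\mathrm{i}\eta)\,\mathrm{e}^{-\mathrm{i}\varphi},\qquad 0\le\varphi<2\pi .$$ With $\varrho=\sqrt{\xi^2+\eta^2}$ this is an ellipse with semi-axes $r+\varrho$ and $|r-\varrho|$ (degenerating to a doubly traversed line segment, of enclosed area $0$, if $\varrho=r$). ''The ellipse generated by $P$'' means this curve, and its area is the area of the region it encloses, i.e. $\pi|r^2-\varrho^2|$. The disk is $D_R=\{(\xi,\eta)\in\varSigma: 0\le\xi^2+\eta^2\le R^2\}$. For $R=0$ the disk is the single point $\varOmega$ and $P=\varOmega$. (Ranges $a\le x<b$ with $a=b$ are empty; in particular for $\varkappa=0$ the expression containing $1/\varkappa^2$ is never used.) *)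

(* Defs.v *)
From HB Require Import structures.
From mathcomp Require Import all_boot all_order all_algebra complex.
From mathcomp Require Import all_classical all_reals all_analysis.

Set Implicit Arguments.
Unset Strict Implicit.
Unset Printing Implicit Defensive.

Import Order.TTheory GRing.Theory Num.Theory.
Import numFieldNormedType.Exports.

Local Open Scope classical_set_scope.
Local Open Scope ring_scope.

(* R^2 as a measurable space (product of the Borel sigma-algebras); it serves
   both as the moving plane, with coordinates (xi, eta), and as the fixed
   plane, a complex number z being the point (Re z, Im z). *)
Notation plane R := (measurableTypeR R * measurableTypeR R)%type.

Definition area (R : realType) : set (plane R) -> \bar R :=
  (@lebesgue_measure R \x @lebesgue_measure R)%E.

Definition expi (R : realType) (phi : R) : R[i] := (cos phi +i* sin phi)%C.

Definition point_of_complex (R : realType) (z : R[i]) : plane R :=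
  (complex.Re z, complex.Im z).

Definition motion (R : realType) (r : R) (p : plane R) (phi : R) : R[i] :=
  (r%:C * expi phi + (p.1 +i* p.2) * expi (- phi))%C.

Definition generated_ellipse (R : realType) (r : R) (p : plane R) :
    set (plane R) :=
  [set point_of_complex (motion r p phi) | phi in `[0, 2 * pi[].

(* The region enclosed by a curve C is the union of the bounded connected
   components of its complement.  The condition ~ C z is needed because
   connected_component A z is empty when z is not in A. *)
Definition enclosed_region (R : realType) (C : set (R * R)) : set (R * R) :=
  [set z | ~ C z /\ bounded_set (connected_component (~` C) z)].

Definition ellipse_area (R : realType) (r : R) (p : plane R) : \bar R :=
  area (enclosed_region (generated_ellipse r p)).

Definition disk (R : realType) (rad : R) : set (plane R) :=
  [set p | 0 <= p.1 ^+ 2 + p.2 ^+ 2 <= rad ^+ 2].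

(* A disk of radius 0 has area 0; the uniform law on it is the point mass at
   its only point. *)
Definition uniform_on_disk d (T : measurableType d) (R : realType)
    (P : probability T R) (rad : R) (Z : {RV P >-> plane R}) : Prop :=
  forall B : set (plane R), measurable B ->
    distribution P Z B =
      (if rad == 0%R then \d_((0%R, 0%R) : plane R) B
       else area (B `&` disk rad) / area (disk rad))%E.

(* Main.v *)
Require Import Defs.
From HB Require Import structures.
From mathcomp Require Import all_boot all_order all_algebra.
From mathcomp Require Import all_classical all_reals all_analysis.
From mathcomp Require Import measurable_realfun ring lra.

Set Implicit Arguments.
Unset Strict Implicit.
Unset Printing Implicit Defensive.

Import Order.TTheory GRing.Theory Num.Theory.
Import numFieldNormedType.Exports.

Local Open Scope classical_set_scope.
Local Open Scope ring_scope.

(** The curve traced by a point p = (xi, eta) is the image of the unit circle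
under the symmetric matrix with rows (r + xi, eta) and (eta, r - xi), because
r e^(i phi) + (xi + i eta) e^(- i phi) is that matrix applied to
(cos phi, sin phi).  Its determinant is D = r^2 - (xi^2 + eta^2).

If D <> 0, the curve is the level set {q = D^2} of the positive definite form
q(z) = |adj z|^2, adj being the adjugate matrix, of determinant D^2.  The
sublevel set {q < D^2} is bounded and is both open and closed in the complement
of the curve, so every component meeting it is bounded; from a point with
q > D^2 the outward ray t z, t >= 1, avoids the curve, so its component is
unbounded.  The enclosed region is therefore {q < D^2}
([enclosed_region_ellipse]), and its area is pi D^2 / |D| = pi |D| by the area
formula for definite quadratic forms ([area_qform]), which comes from slicing:
each vertical section is an interval of half-length proportional to
sqrt (s^2 - x^2).  If D = 0, the curve is a segment through 0, star-shaped with
respect to 0, so the ray t z avoids it as soon as z does, and nothing is enclosed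
([enclosed_region_segment]).

Thus the random area is pi |r^2 - |Z|^2| everywhere, and the event that it is at
most x says that Z lies in the annulus r^2 - x/pi <= |Z|^2 <= r^2 + x/pi.  For
rad > 0 its probability under the uniform law is
   max(0, min(rad^2, r^2 + x/pi) - max(0, r^2 - x/pi)) / rad^2
([cdf_uniform]), and the three regimes of the theorem are the ways in which the
clipping can occur. *)

(** * The area under a half circle *)

(** The derivative of asin blows up at the endpoints, so continuity there is
obtained by viewing x |-> asin (x / s) as the inverse of t |-> s sin t on
[- pi / 2, pi / 2]. *)
Lemma asin_div_continuous_within (R : realType) (s : R) : 0 < s ->
  {within `[(- s), s], continuous (fun x => asin (x / s))}.
Proof.
move=> s0; have le : - (pi / 2) <= pi / 2 :> R by have := @pi_gt0 R; lra.
have := @segment_can_le_continuous R _ _ (fun t => s * sin t)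
  (fun x => asin (x / s)) le.
rewrite sinN sin_pihalf mulrN mulr1; apply.
  apply: continuous_subspaceT => x.
  by apply: continuousM; [exact: cst_continuous|exact: continuous_sin].
by move=> x xI; rewrite mulrAC divff ?mul1r ?gt_eqF// sinK.
Qed.

Lemma is_derive_halfdisk (R : realType) (s x : R) : 0 < s -> - s < x < s ->
  is_derive x 1 (fun x => (x * Num.sqrt (s ^+ 2 - x ^+ 2)
                           + s ^+ 2 * asin (x / s)) / 2)
    (Num.sqrt (s ^+ 2 - x ^+ 2)).
Proof.
move=> s0 /andP[sx xs].
have h0 : 0 < s ^+ 2 - x ^+ 2 by rewrite subr_sqr; nra.
have xs1 : -1 < x / s < 1.
  by rewrite ltr_pdivlMr// ltr_pdivrMr// mulN1r mul1r sx xs.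
set w := Num.sqrt _.
have w0 : 0 < w by rewrite sqrtr_gt0.
have w2 : w ^+ 2 = s ^+ 2 - x ^+ 2 by rewrite sqr_sqrtr// ltW.
have ws : Num.sqrt (1 - (x / s) ^+ 2) = w / s.
  rewrite -[RHS]ger0_norm; last by rewrite divr_ge0// ltW.
  rewrite -sqrtr_sqr; congr Num.sqrt; rewrite !exprMn w2.
  by field; rewrite gt_eqF.
have d1 : is_derive x 1 (fun x => s ^+ 2 - x ^+ 2) (- (2 * x)).
  by apply: is_derive_eq; rewrite /GRing.scale/=; ring.
have d2 : is_derive x 1 (fun x => Num.sqrt (s ^+ 2 - x ^+ 2)) ((2 * w)^-1 * - (2 * x)).
  exact: (@is_derive1_comp R Num.sqrt (fun x => s ^+ 2 - x ^+ 2)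
    x _ _ (is_derive1_sqrt h0) d1).
have d3 : is_derive x 1 (fun x => x / s) s^-1.
  by apply: is_derive_eq; rewrite /GRing.scale/=; ring.
have d4 : is_derive x 1 (fun x => asin (x / s)) ((w / s)^-1 * s^-1).
  by rewrite -ws; exact: (@is_derive1_comp R (@asin R) (fun x => x / s)
    x _ _ (is_derive1_asin xs1) d3).
apply: is_derive_eq; rewrite /GRing.scale/= !mulr0 !add0r.
have -> : (Num.sqrt (s ^+ 2 - x ^+ 2)) = w by [].
have -> : s ^+ 2 = w ^+ 2 + x ^+ 2 by rewrite w2; ring.
by field; rewrite !gt_eqF.
Qed.

(** The integrand vanishes outside [- s, s], because the square root of a
negative number is 0; this is why the integral ranges over the whole line. *)
Lemma integral_halfdisk (R : realType) (s : R) : 0 <= s ->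
  (\int[@lebesgue_measure R]_x (Num.sqrt (s ^+ 2 - x ^+ 2))%:E
   = (pi * s ^+ 2 / 2)%:E)%E.
Proof.
move=> s_ge0.
transitivity (\int[@lebesgue_measure R]_(x in `[(- s)%R, s])
    (Num.sqrt (s ^+ 2 - x ^+ 2))%:E)%E.
  rewrite [RHS]integral_mkcond; apply: eq_integral => x _.
  rewrite patchE; case: ifPn => // /negP xs; congr EFin.
  apply/eqP; rewrite sqrtr_eq0 leNgt; apply/negP => h; apply: xs.
  by rewrite inE/= in_itv/=; rewrite subr_sqr in h; nra.
move: s_ge0; rewrite le_eqVlt => /predU1P[<-|s0].
  by rewrite oppr0 set_itv1 integral_set1 expr0n/= mulr0 mul0r.
have cw : {within `[(- s), s], continuous (fun x => Num.sqrt (s ^+ 2 - x ^+ 2))}.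
  apply: continuous_subspaceT => x; apply: continuous_comp; last first.
    exact: sqrt_continuous.
  by apply: continuousB; [exact: cst_continuous|exact: exprn_continuous].
pose F x := (x * Num.sqrt (s ^+ 2 - x ^+ 2) + s ^+ 2 * asin (x / s)) / 2.
have cF : {within `[(- s), s], continuous F}.
  move=> x; pose S := subspace [set` `[(- s), s]].
  pose w (x : S) : R := Num.sqrt (s ^+ 2 - x ^+ 2).
  pose g (x : S) : R := asin (x / s).
  have cg : {for x, continuous g} by exact: asin_div_continuous_within.
  apply: (@continuousM R S (fun x : S => x * w x + s ^+ 2 * g x) (cst 2^-1));
    last exact: cst_continuous.
  apply: (@continuousD R R S (fun x : S => x * w x) (fun x => s ^+ 2 * g x)).
    apply: (@continuousM R S id w); last exact: cw.
    by apply: continuous_subspaceT => y; exact: cvg_id.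
  by apply: (@continuousM R S (cst (s ^+ 2)) g) => //; exact: cst_continuous.
have ss : - s < s by lra.
have [_ Fl Fr] := (continuous_within_itvP F ss).1 cF.
have dF x : x \in `]- s, s[ -> is_derive x 1 F (Num.sqrt (s ^+ 2 - x ^+ 2)).
  by rewrite in_itv/= => xs; exact: is_derive_halfdisk.
rewrite (@continuous_FTC2 R _ F)//.
- rewrite /F -EFinB; congr EFin.
  rewrite sqrrN subrr sqrtr0 !mulr0 !add0r mulNr divff ?gt_eqF//.
  by rewrite -sin_pihalf -sinN !sinK ?in_itv/=; have := @pi_gt0 R; try lra.
- by split => // x /dF dFx; exact: ex_derive.
- by move=> x /dF dFx; rewrite derive1E derive_val.
Qed.

(** * The area of a region bounded by an ellipse *)

(** The quadratic form with matrix ((a, - b), (- b, c)); its determinant is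
a c - b^2. *)
Definition qform (R : realType) (a b c : R) (z : R * R) : R :=
  a * z.1 ^+ 2 - 2 * b * z.1 * z.2 + c * z.2 ^+ 2.

(** Completing the square in the second variable: it bounds the first
coordinate on sublevel sets and exhibits their vertical sections as
intervals. *)
Lemma qform_square (R : realType) (a b c : R) (z : R * R) :
  c * qform a b c z
  = (c * z.2 - b * z.1) ^+ 2 + (a * c - b ^+ 2) * z.1 ^+ 2.
Proof. by rewrite /qform; ring. Qed.

Lemma lebesgue_measure_sandwich (R : realType) (m h : R)
    (S : set (measurableTypeR R)) : 0 <= h -> measurable S ->
    `]m - h, m + h[ `<=` S -> S `<=` `[m - h, m + h] ->
  lebesgue_measure S = (2 * h)%:E.
Proof.
move=> h0 mS lo hi.
have len : m + h - (m - h) = 2 * h by ring.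
have itvE (i : interval R) : measurable ([set` i] : set (measurableTypeR R)).
  exact: measurable_itv.
have low : lebesgue_measure `]m - h, m + h[ = (2 * h)%:E.
  rewrite lebesgue_measure_itv/= lte_fin -EFinB len.
  by case: ifPn => //; rewrite -leNgt => ?; congr EFin; lra.
have high : lebesgue_measure `[m - h, m + h] = (2 * h)%:E.
  rewrite lebesgue_measure_itv/= lte_fin -EFinB len.
  by case: ifPn => //; rewrite -leNgt => ?; congr EFin; lra.
apply/eqP; rewrite eq_le -{1}high -low; apply/andP; split.
  by apply: le_measure => //; rewrite inE//; exact: itvE.
by apply: le_measure => //; rewrite inE//; exact: itvE.
Qed.

(** E is only pinned between the open and the closed region, so that one
statement serves for both; the two have the same sections up to endpoints.
With s = sqrt (c u) / delta, the section at x is an interval centred at b x / c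
of half-length (delta / c) sqrt (s^2 - x^2). *)
Lemma area_qform (R : realType) (a b c delta u : R) (E : set (plane R)) :
    0 < c -> 0 < delta -> a * c - b ^+ 2 = delta ^+ 2 -> 0 <= u ->
    measurable E -> (forall z, qform a b c z < u -> E z) ->
    (forall z, E z -> qform a b c z <= u) ->
  area E = (pi * u / delta)%:E.
Proof.
move=> c0 delta0 disc u0 mE lo hi.
have [c_neq0 delta_neq0] : c != 0 /\ delta != 0 by rewrite !gt_eqF.
pose s := Num.sqrt (c * u) / delta.
have s0 : 0 <= s by rewrite divr_ge0 ?sqrtr_ge0// ltW.
have s2 : delta ^+ 2 * s ^+ 2 = c * u.
  by rewrite exprMn exprVn mulrCA divff ?mulr1 ?sqrf_eq0// sqr_sqrtr// mulr_ge0// ltW.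
have cE (y x : R) : c * qform a b c (x, y) = (c * y - b * x) ^+ 2 + delta ^+ 2 * x ^+ 2.
  by rewrite qform_square disc.
rewrite /area /product_measure1.
transitivity (\int[@lebesgue_measure R]_x
   ((2 * (delta / c))%:E * (Num.sqrt (s ^+ 2 - x ^+ 2))%:E))%E.
  apply: eq_integral => x _ /=.
  have mS : measurable (xsection E x) by exact: measurable_xsection.
  have [neg|nneg] := ltP (s ^+ 2 - x ^+ 2) 0.
    rewrite ler0_sqrtr ?ltW// mule0 (_ : xsection E x = set0) ?measure0//.
    rewrite -subset0 => y /xsectionP /hi /=; rewrite -(ler_pM2l c0) cE -s2.
    have := sqr_ge0 (c * y - b * x); have := exprn_gt0 2 delta0; nra.
  rewrite -EFinM -mulrA; set h := _ * Num.sqrt _.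
  have h0 : 0 <= h by rewrite mulr_ge0 ?sqrtr_ge0// divr_ge0 ?ltW.
  have h2 : c ^+ 2 * h ^+ 2 = delta ^+ 2 * (s ^+ 2 - x ^+ 2).
    by rewrite /h exprMn sqr_sqrtr//; field.
  have yE y : c * y - b * x = c * (y - b * x / c) by field.
  apply: (@lebesgue_measure_sandwich _ (b * x / c)) => // y.
    rewrite /= in_itv/= => /andP[y1 y2]; apply/xsectionP; apply: lo.
    rewrite -(ltr_pM2l c0) cE -s2 -ltrBrDr -mulrBr -h2 yE exprMn.
    rewrite ltr_pM2l ?exprn_gt0//; nra.
  move=> /xsectionP /hi; rewrite -(ler_pM2l c0) cE -s2 -lerBrDr -mulrBr -h2 yE.
  rewrite exprMn ler_pM2l ?exprn_gt0// => yh; rewrite /= in_itv/=.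
  by apply/andP; split; nra.
rewrite ge0_integralZl//=.
- rewrite integral_halfdisk// -EFinM; congr EFin.
  have -> : s ^+ 2 = c * u / delta ^+ 2 by rewrite -s2; field.
  by field; rewrite delta_neq0.
- apply/measurable_EFinP; apply: continuous_measurable_fun => x.
  apply: continuous_comp; last exact: sqrt_continuous.
  by apply: continuousB; [exact: cst_continuous|exact: exprn_continuous].
- by rewrite lee_fin mulr_ge0// divr_ge0// ltW.
Qed.

Lemma measurable_qform (R : realType) (a b c : R) :
  measurable_fun [set: plane R] (qform a b c : plane R -> measurableTypeR R).
Proof.
apply: measurable_funD.
  apply: measurable_funB.
    by apply: measurable_funM => //; apply: measurable_funX; exact: measurable_fst.
  by apply: measurable_funM; [apply: measurable_funM|exact: measurable_snd].
by apply: measurable_funM => //; apply: measurable_funX; exact: measurable_snd.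
Qed.

(** * The generated curve *)

Lemma unit_circle_param (R : realType) (u : R * R) :
  u.1 ^+ 2 + u.2 ^+ 2 = 1 ->
  exists2 phi, phi \in `[0, 2 * pi[ & (cos phi, sin phi) = u.
Proof.
case: u => x y /= xy1; have pi0 := @pi_gt0 R.
have x1 : -1 <= x <= 1 by have h := sqr_ge0 y; apply/andP; split; nra.
have y2 : 1 - x ^+ 2 = y ^+ 2 by rewrite -xy1; ring.
have cx : cos (acos x) = x by rewrite acosK// in_itv.
have sx : sin (acos x) = `|y| by rewrite sin_acos// y2 sqrtr_sqr.
have [a0 api] := (acos_ge0 x1, acos_lepi x1).
have [y0|y0] := leP 0 y.
  exists (acos x); first by rewrite in_itv/=; apply/andP; split; lra.
  by rewrite cx sx ger0_norm.
exists (2 * pi - acos x).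
  rewrite in_itv/= ltrBlDr ltrDl subr_ge0; apply/andP; split; first lra.
  rewrite lt_neqAle a0 andbT; apply/negP => /eqP a00.
  by move: sx; rewrite -a00 sin0 => /esym/eqP; rewrite normr_eq0 lt_eqF.
have -> : 2 * pi - acos x = - acos x + pi *+ 2 by rewrite mulr2n; ring.
by rewrite cosD2pi sinD2pi cosN sinN cx sx ltr0_norm// opprK.
Qed.

(** The motion read on the unit circle: multiplication by a symmetric matrix,
which makes the half-angle rotation to the principal axes unnecessary. *)
Definition frame_map (R : realType) (r : R) (p u : R * R) : R * R :=
  ((r + p.1) * u.1 + p.2 * u.2, p.2 * u.1 + (r - p.1) * u.2).

Definition frame_det (R : realType) (r : R) (p : R * R) : R :=
  r ^+ 2 - (p.1 ^+ 2 + p.2 ^+ 2).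

(** The form z |-> |adj z|^2, where adj is the adjugate of the matrix of
[frame_map]. *)
Definition frame_form (R : realType) (r : R) (p : R * R) : R * R -> R :=
  qform ((r - p.1) ^+ 2 + p.2 ^+ 2) (2 * r * p.2) ((r + p.1) ^+ 2 + p.2 ^+ 2).

Lemma generated_ellipseE (R : realType) (r : R) (p : R * R) :
  generated_ellipse r p
  = frame_map r p @` [set u : R * R | u.1 ^+ 2 + u.2 ^+ 2 = 1].
Proof.
have motionE phi :
    point_of_complex (motion r p phi) = frame_map r p (cos phi, sin phi).
  rewrite /point_of_complex /motion /expi /frame_map/= cosN sinN.
  by congr pair; ring.
apply/seteqP; split => z.
  move=> [phi _ <-]; rewrite motionE; exists (cos phi, sin phi) => //=.
  by rewrite cos2Dsin2.
by move=> [u /unit_circle_param[phi phiI <-] <-]; exists phi.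
Qed.

Lemma frame_form_map (R : realType) (r : R) (p u : R * R) :
  frame_form r p (frame_map r p u)
  = frame_det r p ^+ 2 * (u.1 ^+ 2 + u.2 ^+ 2).
Proof. by rewrite /frame_form /frame_det /qform /frame_map/=; ring. Qed.

Lemma frame_map_scale (R : realType) (r : R) (p u : R * R) (t : R) :
  frame_map r p (t * u.1, t * u.2)
  = (t * (frame_map r p u).1, t * (frame_map r p u).2).
Proof. by rewrite /frame_map/=; congr pair; ring. Qed.

(** By [frame_form_map] the curve lies in the level set; conversely the
preimage of a point of the level set, given by Cramer's rule, has norm 1. *)
Lemma generated_ellipse_level (R : realType) (r : R) (p : R * R) :
  frame_det r p != 0 ->
  generated_ellipse r p = [set z | frame_form r p z = frame_det r p ^+ 2].
Proof.
set D := frame_det r p => D0; rewrite generated_ellipseE; apply/seteqP; split.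
  by move=> _ [u /= u1 <-]; rewrite frame_form_map u1 mulr1.
move=> z /= zD.
(* u is the adjugate applied to z, divided by the determinant. *)
pose u := (((r - p.1) * z.1 - p.2 * z.2) / D, ((r + p.1) * z.2 - p.2 * z.1) / D).
have uz : frame_map r p u = z.
  rewrite /frame_map/= [RHS]surjective_pairing.
  by congr pair; rewrite /u /D /frame_det/=; field.
have := frame_form_map r p u; rewrite uz zD -/D => u1; exists u => //=.
by apply: (mulfI (expf_neq0 2 D0)); rewrite -u1 mulr1.
Qed.

(** Both columns of the adjugate lie in the kernel when the determinant is 0;
they are not both 0 since the trace of the matrix is 2 r. *)
Lemma frame_kernel (R : realType) (r : R) (p : R * R) :
  0 < r -> frame_det r p = 0 ->
  exists2 k : R * R, k.1 ^+ 2 + k.2 ^+ 2 = 1 & frame_map r p k = (0, 0).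
Proof.
move=> r0 D0.
have [v v0 Mv] : exists2 v : R * R, 0 < v.1 ^+ 2 + v.2 ^+ 2 &
    frame_map r p v = (0, 0).
  have [q0|q0] := eqVneq (p.1, p.2) (r, 0).
    case: q0 => p1 p2; exists (0, 1); first by rewrite /= expr0n expr1n add0r.
    by rewrite /frame_map/= p1 p2; congr pair; ring.
  exists (r - p.1, - p.2).
    rewrite /= lt_neqAle addr_ge0 ?sqr_ge0// andbT eq_sym paddr_eq0 ?sqr_ge0//.
    rewrite !sqrf_eq0 oppr_eq0 subr_eq0; apply/negP => /andP[/eqP r1 /eqP p2].
    by rewrite -r1 p2 eqxx in q0.
  by rewrite /frame_map/=; congr pair; [rewrite -[RHS]D0 /frame_det|]; ring.
pose n := Num.sqrt (v.1 ^+ 2 + v.2 ^+ 2).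
have n0 : n != 0 by rewrite gt_eqF// sqrtr_gt0.
exists (n^-1 * v.1, n^-1 * v.2).
  by rewrite /= !exprMn -mulrDr exprVn sqr_sqrtr ?mulVf ?gt_eqF// ltW.
by rewrite frame_map_scale Mv/= mulr0.
Qed.

(** Let u be a unit vector mapped to t z, and w its component orthogonal to the
unit kernel vector k.  Then w / t is mapped to z and has norm at most 1, and
adding a suitable multiple s k restores norm 1 without changing the image. *)
Lemma generated_segment_star (R : realType) (r : R) (p z : R * R) (t : R) :
  0 < r -> frame_det r p = 0 -> 1 <= t ->
  generated_ellipse r p (t * z.1, t * z.2) -> generated_ellipse r p z.
Proof.
move=> r0 D0 t1; rewrite generated_ellipseE.
have [k k1 Mk] := frame_kernel r0 D0 => -[u /= u1 Mu].
pose d := u.1 * k.1 + u.2 * k.2.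
pose w := (u.1 - d * k.1, u.2 - d * k.2).
have w2 : w.1 ^+ 2 + w.2 ^+ 2 = 1 - d ^+ 2.
  have -> : w.1 ^+ 2 + w.2 ^+ 2 = (u.1 ^+ 2 + u.2 ^+ 2)
    - 2 * d * d + d ^+ 2 * (k.1 ^+ 2 + k.2 ^+ 2) by rewrite /w /d/=; ring.
  by rewrite u1 k1; ring.
have wk : w.1 * k.1 + w.2 * k.2 = 0.
  have -> : w.1 * k.1 + w.2 * k.2 = d - d * (k.1 ^+ 2 + k.2 ^+ 2).
    by rewrite /w /d/=; ring.
  by rewrite k1; ring.
have t0 : t != 0 by rewrite gt_eqF// (lt_le_trans ltr01).
pose e := (1 - d ^+ 2) / t ^+ 2.
have e1 : e <= 1.
  rewrite ler_pdivrMr ?exprn_gt0 ?(lt_le_trans ltr01)//.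
  by have := sqr_ge0 d; nra.
pose s := Num.sqrt (1 - e).
have s2 : s ^+ 2 = 1 - e by rewrite sqr_sqrtr// subr_ge0.
exists (w.1 / t + s * k.1, w.2 / t + s * k.2) => /=.
  transitivity ((w.1 ^+ 2 + w.2 ^+ 2) / t ^+ 2
    + 2 * s / t * (w.1 * k.1 + w.2 * k.2) + s ^+ 2 * (k.1 ^+ 2 + k.2 ^+ 2)).
    by rewrite /w/=; field.
  by rewrite w2 wk k1 s2 /e; field.
move: Mu Mk; rewrite /frame_map/= => -[Mu1 Mu2] [Mk1 Mk2].
rewrite [RHS]surjective_pairing; congr pair.
  transitivity (((r + p.1) * u.1 + p.2 * u.2) / t
    + (s - d / t) * ((r + p.1) * k.1 + p.2 * k.2)); first by field.
  by rewrite Mk1 Mu1; field.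
transitivity ((p.2 * u.1 + (r - p.1) * u.2) / t
  + (s - d / t) * (p.2 * k.1 + (r - p.1) * k.2)); first by field.
by rewrite Mk2 Mu2; field.
Qed.

(** * Bounded and unbounded components of a complement *)

Lemma continuous_qform (R : realType) (a b c : R) :
  continuous (qform a b c : R * R -> R).
Proof.
move=> z.
have c1 : {for z, continuous (fst : R * R -> R)} by exact: cvg_fst.
have c2 : {for z, continuous (snd : R * R -> R)} by exact: cvg_snd.
have cX (f : R * R -> R) : {for z, continuous f} ->
    {for z, continuous (fun x => f x ^+ 2)}.
  by move=> cf; exact: (@continuousM R _ f f).
have cM k (f : R * R -> R) : {for z, continuous f} ->
    {for z, continuous (fun x => k * f x)}.
  by move=> cf; apply: (@continuousM R _ (cst k) f) => //; exact: cst_continuous.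
apply: (@continuousD R R _ (fun z : R * R => a * z.1 ^+ 2 - 2 * b * z.1 * z.2)
  (fun z : R * R => c * z.2 ^+ 2)); last exact/cM/cX.
apply: (@continuousB R R _ (fun z : R * R => a * z.1 ^+ 2)
  (fun z : R * R => 2 * b * z.1 * z.2)); first exact/cM/cX.
by apply: (@continuousM R _ (fun z : R * R => 2 * b * z.1) snd) => //; exact: cM.
Qed.

(** Off the level {q = u} the conditions q < u and q <= u agree, so the part of
the component where q < u is open and closed in it. *)
Lemma component_sublevel (T : topologicalType) (R : realType) (q : T -> R)
    (u : R) (z : T) : continuous q -> q z < u ->
  connected_component (~` [set x | q x = u]) z `<=` [set x | q x < u].
Proof.
move=> cq zu; set K := connected_component _ z.
have Kz : K z by apply: connected_component_refl => /= zq; rewrite zq ltxx in zu.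
have KI : K `&` [set x | q x < u] = K `&` [set x | q x <= u].
  apply/seteqP; split => x /= [Kx].
    by move=> /ltW.
  move=> xu; split => //; rewrite lt_neqAle xu andbT.
  by apply/eqP; exact: connected_component_sub Kx.
rewrite -setIidPl; apply: component_connected.
- by exists z.
- exists [set x | q x < u] => //.
  by apply: (@open_comp _ _ q [set y | y < u]) => //; exact: open_lt.
- exists [set x | q x <= u] => //.
  by apply: (@preimage_closed _ _ q [set y | y <= u]) => //; exact: closed_le.
Qed.

(** The ray from z away from the origin is connected, so the component contains
all of it. *)
Lemma unbounded_component (R : realType) (A : set (R * R)) (z : R * R) :
    z != (0, 0) -> (forall t, 1 <= t -> A (t * z.1, t * z.2)) ->
  ~ bounded_set (connected_component A z).
Proof.
move=> z0 rayA [M [_ HM]].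
pose ray (t : R) : R * R := (t * z.1, t * z.2).
have cray : continuous ray.
  have cl (k : R) : continuous (fun t : R => t * k) by exact: mulrr_continuous.
  by move=> t; exact: (cvg_pair (cl z.1 t) (cl z.2 t)).
have rayK : ray @` `[1, +oo[ `<=` connected_component A z.
  apply: connected_component_max.
  - by exists 1; rewrite /ray ?mul1r -?surjective_pairing//= in_itv/= lexx.
  - by move=> _ [t /= + <-]; rewrite in_itv/= andbT => /rayA.
  - apply: connected_continuous_connected; last exact: continuous_subspaceT.
    by apply/connected_intervalP; exact: interval_is_interval.
have n0 : 0 < `|z| by rewrite normr_gt0.
(* This t makes the norm of t z equal to |z| + |M| + 1, beyond the bound M. *)
pose t := 1 + (`|M| + 1) / `|z|.
have t1 : 1 <= t by rewrite lerDl divr_ge0// addr_ge0.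
have Kt : connected_component A z (ray t).
  by apply: rayK; exists t; rewrite //= in_itv/= t1.
have MM : M < `|M| + 1 by have := ler_norm M; lra.
have : `|t *: z| <= `|M| + 1 by exact: (HM _ MM _ Kt).
rewrite normrZ ger0_norm ?(le_trans ler01)// /t mulrDl mul1r divfK ?gt_eqF//.
by lra.
Qed.

(** Completing the square in either variable bounds the other one. *)
Lemma bounded_qform_sublevel (R : realType) (a b c u : R) :
  0 < c -> 0 < a * c - b ^+ 2 -> bounded_set [set z | qform a b c z < u].
Proof.
move=> c0 disc.
have a0 : 0 < a by rewrite -(pmulr_lgt0 _ c0); have := sqr_ge0 b; lra.
have swap z : qform a b c z = qform c b a (z.2, z.1) by rewrite /qform/=; ring.
pose d := a * c - b ^+ 2.
exists (1 + (a + c) * `|u| / d); split; first exact: num_real.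
move=> M MM z /= zu; apply: le_trans (ltW MM).
have b1 (x k : R) : 0 < k -> k <= a + c -> d * x ^+ 2 < k * u ->
    `|x| <= 1 + (a + c) * `|u| / d.
  move=> k0 kac xk.
  have h1 : x ^+ 2 <= (a + c) * `|u| / d.
    rewrite ler_pdivlMr// mulrC (le_trans (ltW xk))//.
    by rewrite (le_trans (ler_wpM2l (ltW k0) (ler_norm u)))// ler_wpM2r.
  rewrite -real_normK ?num_real// in h1.
  by have := sqr_ge0 (`|x| - 1); have := normr_ge0 x; nra.
rewrite prod_normE ge_max; apply/andP; split.
  apply: (b1 _ c) => //; first lra.
  have := qform_square a b c z; rewrite -(ltr_pM2l c0) in zu.
  by have := sqr_ge0 (c * z.2 - b * z.1); rewrite -/d; lra.
apply: (b1 _ a) => //; first lra.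
rewrite swap in zu; have := qform_square c b a (z.2, z.1).
rewrite -(ltr_pM2l a0) in zu.
by have := sqr_ge0 (a * z.1 - b * z.2); rewrite (mulrC c a) -/d/=; lra.
Qed.

(** * The enclosed region and its area *)

Lemma frame_disc (R : realType) (r : R) (p : R * R) :
  ((r - p.1) ^+ 2 + p.2 ^+ 2) * ((r + p.1) ^+ 2 + p.2 ^+ 2)
  - (2 * r * p.2) ^+ 2 = frame_det r p ^+ 2.
Proof. by rewrite /frame_det; ring. Qed.

(** If the coefficient were 0, the discriminant identity [frame_disc] would
read - (2 r eta)^2 = D^2, forcing D = 0. *)
Lemma frame_form_coef_gt0 (R : realType) (r : R) (p : R * R) :
  frame_det r p != 0 -> 0 < (r + p.1) ^+ 2 + p.2 ^+ 2.
Proof.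
move=> D0; rewrite lt_neqAle addr_ge0 ?sqr_ge0// andbT; apply/eqP => c0.
have := frame_disc r p; rewrite -c0 => h; case/eqP: (expf_neq0 2 D0).
by have := sqr_ge0 (2 * r * p.2); have := sqr_ge0 (frame_det r p); lra.
Qed.

Lemma enclosed_region_ellipse (R : realType) (r : R) (p : R * R) :
  frame_det r p != 0 ->
  enclosed_region (generated_ellipse r p)
  = [set z | frame_form r p z < frame_det r p ^+ 2].
Proof.
move=> D0; have D2 : 0 < frame_det r p ^+ 2.
  by rewrite lt_neqAle sqr_ge0 eq_sym expf_neq0.
have c0 := frame_form_coef_gt0 D0.
have -> : generated_ellipse r p = [set z | frame_form r p z = frame_det r p ^+ 2].
  exact: generated_ellipse_level.
apply/seteqP; split => z /=.
  move=> [/eqP zD bz]; rewrite lt_neqAle zD/= leNgt; apply/negP => Dz.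
  apply: unbounded_component bz => [|t t1 /=].
    apply/eqP => z0; move: Dz; rewrite z0 /frame_form /qform/=.
    by rewrite expr0n/= !mulr0 subr0 addr0 ltNge ltW.
  have -> : frame_form r p (t * z.1, t * z.2) = t ^+ 2 * frame_form r p z.
    by rewrite /frame_form /qform/=; ring.
  apply/eqP; rewrite gt_eqF// (lt_le_trans Dz)// ler_peMl ?(ltW (lt_trans D2 Dz))//.
  exact: exprn_ege1.
move=> zD; split; first by move=> zE; rewrite zE ltxx in zD.
have [|M [Mr HM]] := bounded_qform_sublevel (b := 2 * r * p.2)
  (a := (r - p.1) ^+ 2 + p.2 ^+ 2) (frame_det r p ^+ 2) c0.
  by rewrite frame_disc.
exists M; split => // N MN y Ky; apply: HM MN _ _.
have cq : continuous (frame_form r p) by exact: continuous_qform.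
exact: (component_sublevel cq zD) Ky.
Qed.

Lemma enclosed_region_segment (R : realType) (r : R) (p : R * R) :
  0 < r -> frame_det r p = 0 ->
  enclosed_region (generated_ellipse r p) = set0.
Proof.
move=> r0 D0; rewrite -subset0 => z [zC]; apply: unbounded_component.
  apply/eqP => z0; apply: zC; rewrite z0 generated_ellipseE.
  by have [k k1 Mk] := frame_kernel r0 D0; exists k.
by move=> t t1 /(generated_segment_star r0 D0 t1).
Qed.

(** In the regular case, [area_qform] with u = D^2 and delta = |D|; in the
degenerate case both sides are 0. *)
Lemma ellipse_areaE (R : realType) (r : R) (p : plane R) : 0 < r ->
  ellipse_area r p = (pi * `|frame_det r p|)%:E.
Proof.
move=> r0; rewrite /ellipse_area; have [D0|D0] := eqVneq (frame_det r p) 0.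
  by rewrite enclosed_region_segment// D0 normr0 mulr0 /area measure0.
rewrite enclosed_region_ellipse//.
rewrite (@area_qform _ ((r - p.1) ^+ 2 + p.2 ^+ 2) (2 * r * p.2) _
  `|frame_det r p| (frame_det r p ^+ 2) _ (frame_form_coef_gt0 D0)).
- congr EFin; rewrite -[X in pi * X / _]real_normK ?num_real//.
  by field; rewrite normr_eq0.
- by rewrite normr_gt0.
- by rewrite frame_disc real_normK ?num_real.
- exact: sqr_ge0.
- rewrite -[X in measurable X]setTI.
  exact: (measurable_qform _ _ _ measurableT (measurable_itv `]-oo, _[)).
- by [].
- by move=> z /ltW.
Qed.

(** * Areas of disks and annuli *)

Definition sqnorm (R : realType) (p : plane R) : R := p.1 ^+ 2 + p.2 ^+ 2.

Lemma sqnormE (R : realType) : @sqnorm R = qform 1 0 1.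
Proof. by apply/funext => p; rewrite /sqnorm /qform; ring. Qed.

Lemma measurable_sqnorm (R : realType) : measurable_fun [set: plane R] (@sqnorm R).
Proof. by rewrite sqnormE; exact: measurable_qform. Qed.

Lemma measurable_sqnorm_itv (R : realType) (i : interval R) :
  measurable [set p : plane R | sqnorm p \in i].
Proof.
rewrite -[X in measurable X]setTI.
exact: (measurable_sqnorm measurableT (measurable_itv i)).
Qed.

Lemma area_disk_sandwich (R : realType) (u : R) (E : set (plane R)) : 0 <= u ->
  measurable E -> (forall p, sqnorm p < u -> E p) ->
  (forall p, E p -> sqnorm p <= u) -> area E = (pi * u)%:E.
Proof.
move=> u0 mE; rewrite sqnormE => lo hi.
rewrite (@area_qform _ 1 0 1 1 u E)//; first by rewrite divr1.
by rewrite expr0n expr1n/= subr0 mulr1.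
Qed.

Lemma areaD (R : realType) (A B : set (plane R)) :
  measurable A -> measurable B -> (area A < +oo)%E ->
  area (A `\` B) = (area A - area (A `&` B))%E.
Proof. exact: (@measureD _ _ _ (@lebesgue_measure R \x @lebesgue_measure R)%E). Qed.

(** The maximum with 0 covers the empty annulus v < u; otherwise a closed disk
minus an open one is measured. *)
Lemma area_annulus (R : realType) (u v : R) : 0 <= u ->
  area [set p : plane R | u <= sqnorm p <= v] = (pi * Num.max 0 (v - u))%:E.
Proof.
move=> u0; have [uv|vu] := leP u v; last first.
  rewrite max_l ?subr_le0 ?(ltW vu)// mulr0 (_ : [set _ | _] = set0).
    by rewrite /area measure0.
  by rewrite -subset0 => p /= /andP[up pv]; have := le_trans up pv; rewrite leNgt vu.
rewrite max_r ?subr_ge0//.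
have mi := @measurable_sqnorm_itv R.
have v0 := le_trans u0 uv.
have Av : area [set p : plane R | sqnorm p \in `]-oo, v]] = (pi * v)%:E.
  by apply: area_disk_sandwich => // p; rewrite /= in_itv//= => /ltW.
have Au : area [set p : plane R | sqnorm p \in `]-oo, u[] = (pi * u)%:E.
  by apply: area_disk_sandwich => // p; rewrite /= in_itv//= => /ltW.
have -> : [set p : plane R | u <= sqnorm p <= v]
    = [set p | sqnorm p \in `]-oo, v]] `\` [set p | sqnorm p \in `]-oo, u[].
  apply/seteqP; split => p /=; rewrite !in_itv/=.
    by move=> /andP[up ->]; split => //; apply/negP; rewrite -leNgt.
  by move=> [-> /negP]; rewrite -leNgt => ->.
have Avoo : (area [set p : plane R | sqnorm p \in `]-oo, v]] < +oo)%E.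
  by rewrite Av ltry.
rewrite areaD; [|exact: mi|exact: mi|exact: Avoo].
rewrite (setIidr (A := [set p : plane R | sqnorm p \in `]-oo, v]])).
  by rewrite Av Au -EFinB -mulrBr.
move=> p /=; rewrite !in_itv/= => /ltW pu.
exact: le_trans pu uv.
Qed.

(** * The distribution of the area *)

Lemma ellipse_area_le (R : realType) (r x : R) (p : plane R) :
  (pi * `|frame_det r p| <= x)
  = (r ^+ 2 - x / pi <= sqnorm p <= r ^+ 2 + x / pi).
Proof.
rewrite mulrC -ler_pdivlMr ?pi_gt0// ler_norml -/(sqnorm p) andbC.
by rewrite lerBlDr -lerBlDl (lerBlDr (r ^+ 2)) (lerNl (_ / _)) opprB lerBlDl.
Qed.

Lemma measurable_area_le (R : realType) (r x : R) :
  measurable [set p : plane R | pi * `|frame_det r p| <= x].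
Proof.
rewrite (_ : [set _ | _] =
    [set p | sqnorm p \in `[r ^+ 2 - x / pi, r ^+ 2 + x / pi]]).
  exact: measurable_sqnorm_itv.
by apply/seteqP; split => p; rewrite /= in_itv/= ellipse_area_le.
Qed.

Lemma cdf_distribution (d : measure_display) (T : measurableType d)
    (R : realType) (P : probability T R) (r x : R) (Z : {RV P >-> plane R})
    (A : {RV P >-> R}) : (forall w, A w = pi * `|frame_det r (Z w)|) ->
  cdf A x = distribution P Z [set p | pi * `|frame_det r p| <= x].
Proof.
move=> AE; rewrite /cdf /distribution /pushforward; congr (P _).
by apply/seteqP; split => w /=; rewrite in_itv/= AE.
Qed.

Lemma slice_annulus (R : realType) (r rad x : R) :
  [set p : plane R | pi * `|frame_det r p| <= x] `&` disk rad
  = [set p | Num.max 0 (r ^+ 2 - x / pi) <= sqnorm p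
             <= Num.min (rad ^+ 2) (r ^+ 2 + x / pi)].
Proof.
apply/seteqP; split => p; rewrite /disk /= -/(sqnorm p) ellipse_area_le ge_max le_min.
  by move=> [/andP[-> ->] /andP[-> ->]].
by move=> /andP[/andP[-> ->] /andP[-> ->]].
Qed.

Lemma area_disk (R : realType) (rad : R) :
  area (disk rad) = (pi * rad ^+ 2)%:E.
Proof. by rewrite area_annulus// subr0 max_r// sqr_ge0. Qed.

Lemma cdf_uniform (d : measure_display) (T : measurableType d) (R : realType)
    (P : probability T R) (r rad x : R) (Z : {RV P >-> plane R})
    (A : {RV P >-> R}) : 0 < rad -> uniform_on_disk rad Z ->
    (forall w, A w = pi * `|frame_det r (Z w)|) ->
  cdf A x = (Num.max 0 (Num.min (rad ^+ 2) (r ^+ 2 + x / pi)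
                        - Num.max 0 (r ^+ 2 - x / pi)) / rad ^+ 2)%:E.
Proof.
move=> rad0 unifZ AE.
rewrite (cdf_distribution _ AE) (unifZ _ (measurable_area_le r x)) gt_eqF//.
rewrite slice_annulus area_annulus ?le_max ?lexx// area_disk.
rewrite inver mulf_eq0 !gt_eqF ?exprn_gt0 ?pi_gt0//=.
apply: (congr1 EFin).
by rewrite -mulf_div divff ?mul1r// gt_eqF// pi_gt0.
Qed.

Lemma cdf_uniform0 (d : measure_display) (T : measurableType d) (R : realType)
    (P : probability T R) (r x : R) (Z : {RV P >-> plane R})
    (A : {RV P >-> R}) : uniform_on_disk 0 Z ->
    (forall w, A w = pi * `|frame_det r (Z w)|) ->
  cdf A x = (if x < pi * r ^+ 2 then 0 else 1)%:E.
Proof.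
move=> unifZ AE.
rewrite (cdf_distribution _ AE) (unifZ _ (measurable_area_le r x)) eqxx diracE; congr EFin.
have centre : frame_det r (0, 0) = r ^+ 2 by rewrite /frame_det expr0n/= addr0 subr0.
case: ltP => xr; first rewrite memNset//=; last rewrite mem_set//=;
  rewrite centre ger0_norm ?sqr_ge0//.
by apply/negP; rewrite -ltNge.
Qed.

Lemma measurable_ellipse_area (R : realType) (r : R) :
  measurable_fun [set: plane R]
    ((fun p => pi * `|frame_det r p|) : plane R -> measurableTypeR R).
Proof.
apply: measurable_funM => //; apply: measurableT_comp; first exact: normr_measurable.
by apply: measurable_funB => //; exact: measurable_sqnorm.
Qed.

(** In the three lemmas below s = r^2, q is the squared radius of the disk and
y = x / pi; their right-hand sides are the regimes of the theorem multiplied by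
q. *)
Lemma slice_width_small (R : realType) (s q y : R) : q <= s -> 0 < q ->
  Num.max 0 (Num.min q (s + y) - Num.max 0 (s - y))
  = if y < s - q then 0 else if y < s then q - s + y else q.
Proof.
move=> qs q0; case: (ltP y (s - q)) => h1; [|case: (ltP y s) => h2];
  by case: (leP q (s + y)) => h3; case: (leP 0 (s - y)) => h4;
     case: leP => h5; lra.
Qed.

Lemma slice_width_medium (R : realType) (s q y : R) : s <= q <= 2 * s ->
  Num.max 0 (Num.min q (s + y) - Num.max 0 (s - y))
  = if y < 0 then 0 else if y < q - s then 2 * y
    else if y < s then q - s + y else q.
Proof.
move=> /andP[sq qs]; case: (ltP y 0) => h0;
  [|case: (ltP y (q - s)) => h1; [|case: (ltP y s) => h2]];
  by case: (leP q (s + y)) => h3; case: (leP 0 (s - y)) => h4;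
     case: leP => h5; lra.
Qed.

Lemma slice_width_large (R : realType) (s q y : R) : 0 < s -> 2 * s <= q ->
  Num.max 0 (Num.min q (s + y) - Num.max 0 (s - y))
  = if y < 0 then 0 else if y < s then 2 * y
    else if y < q - s then s + y else q.
Proof.
move=> s0 sq; case: (ltP y 0) => h0;
  [|case: (ltP y s) => h1; [|case: (ltP y (q - s)) => h2]];
  by case: (leP q (s + y)) => h3; case: (leP 0 (s - y)) => h4;
     case: leP => h5; lra.
Qed.

Theorem mainTheorem3 (d : measure_display) (T : measurableType d)
    (R : realType) (P : probability T R) (r rad : R) (Z : {RV P >-> plane R}) :
  0 < r -> 0 <= rad -> uniform_on_disk rad Z ->
  let k := rad / r in
  let a := pi * r ^+ 2 in
  exists A : {RV P >-> R},
    (forall w : T, (A w)%:E = ellipse_area r (Z w)) /\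
    [/\ 0 <= k <= 1 ->
        forall x : R, cdf A x =
          (if x < a * (1 - k ^+ 2) then 0
           else if x < a then 1 - 1 / k ^+ 2 * (1 - x / a)
           else 1)%:E,
        1 <= k <= Num.sqrt 2 ->
        forall x : R, cdf A x =
          (if x < 0 then 0
           else if x < a * (k ^+ 2 - 1) then 2 * x / (a * k ^+ 2)
           else if x < a then 1 - 1 / k ^+ 2 * (1 - x / a)
           else 1)%:E
      & Num.sqrt 2 <= k ->
        forall x : R, cdf A x =
          (if x < 0 then 0
           else if x < a then 2 * x / (a * k ^+ 2)
           else if x < a * (k ^+ 2 - 1) then 1 / k ^+ 2 * (1 + x / a)
           else 1)%:E].
Proof.
move=> r0 rad0 unifZ k a.
have mA : measurable_fun [set: T]
    ((fun w => pi * `|frame_det r (Z w)|) : T -> measurableTypeR R).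
  exact: (measurableT_comp (measurable_ellipse_area r) (measurable_funPT Z)).
pose A : {RV P >-> R} := mfun_Sub (mem_set mA).
have AE w : A w = pi * `|frame_det r (Z w)| by [].
exists A; split => [w|]; first by rewrite ellipse_areaE.
have pi0 := @pi_gt0 R; have r20 : 0 < r ^+ 2 by rewrite exprn_gt0.
have a0 : 0 < a by rewrite mulr_gt0.
have k2 : k ^+ 2 = rad ^+ 2 / r ^+ 2 by rewrite expr_div_n.
have aE (x c : R) : (x < a * c) = (x / pi < r ^+ 2 * c).
  by rewrite ltr_pdivrMr// /a (mulrC pi) mulrAC.
have aE1 (x : R) : (x < a) = (x / pi < r ^+ 2) by rewrite -(mulr1 a) aE mulr1.
have x0E (x : R) : (x < 0) = (x / pi < 0) by rewrite pmulr_llt0 ?invr_gt0.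
have r2k : r ^+ 2 * k ^+ 2 = rad ^+ 2 by rewrite k2 mulrCA divff ?mulr1// gt_eqF.
have k0 : 0 <= k by rewrite divr_ge0// ltW.
(* For rad = 0 the law is the point mass at the origin, where the area is a. *)
move: rad0; rewrite le_eqVlt => /predU1P[rad00|rad_gt0].
  have kz : k = 0 by rewrite /k -rad00 mul0r.
  rewrite -rad00 in unifZ; split.
  - move=> _ x; rewrite (cdf_uniform0 x unifZ AE) kz expr0n/= subr0 mulr1.
    by rewrite -/a; case: ifP.
  - by rewrite kz ler10.
  - by rewrite kz leNgt sqrtr_gt0 ltr0n.
have q0 : 0 < rad ^+ 2 by rewrite exprn_gt0.
have cdfE x := cdf_uniform x rad_gt0 unifZ AE.
have v0 : 0 / rad ^+ 2 = 0 by rewrite mul0r.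
have v1 : rad ^+ 2 / rad ^+ 2 = 1 by rewrite divff// gt_eqF.
have xa (x : R) : x / a = x / pi / r ^+ 2 by rewrite /a invfM mulrA.
have vD (x : R) : (rad ^+ 2 - r ^+ 2 + x / pi) / rad ^+ 2 = 1 - 1 / k ^+ 2 * (1 - x / a).
  by rewrite xa k2; move: (x / pi) => y; field; rewrite !gt_eqF.
have ak : pi * rad ^+ 2 = a * k ^+ 2 by rewrite -r2k mulrA.
have v2 (x : R) : 2 * (x / pi) / rad ^+ 2 = 2 * x / (a * k ^+ 2).
  by rewrite -ak (invfM pi) !mulrA.
have vS (x : R) : (r ^+ 2 + x / pi) / rad ^+ 2 = 1 / k ^+ 2 * (1 + x / a).
  by rewrite xa k2; move: (x / pi) => y; field; rewrite !gt_eqF.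
have kq (c : R) : (c <= k ^+ 2) = (r ^+ 2 * c <= rad ^+ 2).
  by rewrite -r2k ler_pM2l.
have qk (c : R) : (k ^+ 2 <= c) = (rad ^+ 2 <= r ^+ 2 * c).
  by rewrite -r2k ler_pM2l.
split => [/andP[_ k1]|/andP[k1 ks]|ks] x; rewrite cdfE; congr EFin.
- have : k ^+ 2 <= 1 by rewrite expr_le1.
  rewrite qk mulr1 => qr; rewrite slice_width_small// aE aE1 mulrBr mulr1 r2k.
  by case: ifP => _; [|case: ifP => _]; rewrite ?mul0r ?vD ?v1.
- have : 1 <= k ^+ 2 by rewrite exprn_ege1.
  have : k ^+ 2 <= 2 by rewrite -ler_sqrt// sqrtr_sqr ger0_norm.
  rewrite kq qk mulr1 (mulrC _ 2) => qr rq.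
  rewrite slice_width_medium ?rq// (x0E x) aE aE1 mulrBr mulr1 r2k.
  case: ifP => _; [|case: ifP => _; [|case: ifP => _]];
    by rewrite ?mul0r ?v2 ?vD ?v1.
- have : 2 <= k ^+ 2 by rewrite -ler_sqrt ?exprn_ge0// sqrtr_sqr ger0_norm.
  rewrite kq (mulrC _ 2) => rq.
  rewrite slice_width_large// (x0E x) aE aE1 mulrBr mulr1 r2k.
  case: ifP => _; [|case: ifP => _; [|case: ifP => _]];
    by rewrite ?mul0r ?v2 ?vS ?v1.
Qed.
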